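(* Let $p>2$ be a prime and $\lambda$ an ordering of $\mathbb{F}_p\times\mathbb{F}_p$, and let $q_1,r_1,\sigma\in\mathrm{Aut}\,X^*$ be the associated automorphisms. The group $H=\langle q_1,r_1,\sigma\rangle$ is a $\mathsf{G}$ group with finite directed part, defined by a periodic sequence of homomorphisms with period $p^2$.
   Context: Tree automorphisms. Let $p>2$ be a prime and $X=\{0,1,\dots,p-1\}$, identified with the field $\mathbb{F}_p$. The set $X^*$ of finite words over $X$ is a rooted $p$-ary tree (root the empty word; $w$ is joined to $wx$). For $g\in\mathrm{Aut}\,X^*$ and $v\in X^*$, the restriction $g|_v\in \mathrm{Aut}\,X^*$ is defined by $g(vw)=g(v)\,g|_v(w)$. Write $g=(g|_0,g|_1,\dots,g|_{p-1})\pi_g$, where $\pi_g$ is the permutation of $X$ induced by $g$ (omitted if trivial). Any permutation $\pi$ of $X$ is also regarded as the automorphism $(1,\dots,1)\pi$. Let $\sigma=(0,1,\dots,p-1)$ be the cyclic permutation $x\mapsto x+1$ of $X$. The automorphisms $q_i,r_i$. Let $\lambda=\{(\alpha_i,\beta_i): i=1,\dots,p^2\}$ be an ordering (enumeration without repetition) of all pairs in $\mathbb{F}_p\times\mathbb{F}_p$. Put $u_i=0$, $v_i=1$ if $\beta_i=0$, and $u_i=1$, $v_i=-\alpha_i/\beta_i$ if $\beta_i\neq 0$. Define $q_i,r_i\in\mathrm{Aut}\,X^*$ ($i=1,\dots,p^2$, indices taken modulo $p^2$) recursively by $$q_i=(q_{i+1},\sigma^{u_i},1,\dots,1),\qquad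 r_i=(r_{i+1},\sigma^{v_i},1,\dots,1).$$ $\mathsf{G}$ groups. Let $R$ be a subgroup of $\mathrm{Sym}(X)$ and let $D$ be a group with a sequence of homomorphisms $w_i:D\to\mathrm{Sym}(X)$, $i\ge1$. $R$ acts on $X^*$ by permuting the first letter. Each $d\in D$ defines the automorphism $\hat d$ of $X^*$ that acts trivially on the first level, with $\hat d|_{0^{i-1}1}=w_i(d)$ for $i\ge 1$, while all other restrictions (that is, $\hat d|_w$ for words $w$ not of the form $0^{i-1}1$) act trivially on $X$. Let $\hat D=\{\hat d: d\in D\}$. The group $G=\langle R,\hat D\rangle$ is called a $\mathsf{G}$ group (with root part $R$ and directed part $D$, defined by the sequence $(w_i)$) if: (i) $R$ and each $w_i(D)$, $i\ge1$, act transitively on $X$; (ii) for each $d\in D$ the permutation $w_i(d)$ is trivial for infinitely many $i$; (iii) for each nontrivial $d\in D$ the permutation $w_i(d)$ is nontrivial for infinitely many $i$. *)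

(* Defs.v *)
(* MathComp, with the classical-set layer of MathComp-Analysis. *)
From HB Require Import structures.
From mathcomp Require Import all_boot all_order all_algebra all_fingroup.
From mathcomp Require Import boolp classical_sets functions cardinality.
Set Implicit Arguments.
Unset Strict Implicit.
Unset Printing Implicit Defensive.
Import GRing.Theory.
Local Open Scope classical_set_scope.

Definition adjacent (T : Type) (v w : seq T) : Prop :=
  (exists x, w = rcons v x) \/ (exists x, v = rcons w x).

Definition is_tree_aut (T : Type) (g : seq T -> seq T) : Prop :=
  [/\ bijective g, g [::] = [::]
    & forall v w, adjacent (g v) (g w) <-> adjacent v w].

Record tree_aut (T : Type) := TreeAut {
  aut_fun :> seq T -> seq T;
  aut_funP : is_tree_aut aut_fun }.

HB.instance Definition _ (T : Type) := gen_eqMixin (tree_aut T).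
HB.instance Definition _ (T : Type) := gen_choiceMixin (tree_aut T).

Section TreeAutGroup.
Variable T : Type.
Implicit Types g h : tree_aut T.

Lemma tree_autP g h : g =1 h -> g = h.
Proof.
case: g h => [g gP] [h hP] /= /funext gh; subst h.
by rewrite (Prop_irrelevance gP hP).
Qed.

Lemma is_tree_aut_id : is_tree_aut (@id (seq T)).
Proof. by split=> //; exists id. Qed.

Lemma is_tree_aut_comp g h : is_tree_aut (h \o g).
Proof.
case: (aut_funP g) (aut_funP h) => gB g0 gA [hB h0 hA].
split; first exact: bij_comp.
  by rewrite /= g0 h0.
by move=> v w; rewrite /= hA gA.
Qed.

Lemma tree_aut_inv_subproof g :
  exists f, [/\ is_tree_aut f, cancel g f & cancel f g].
Proof.
case: (aut_funP g) => -[f gK fK] g0 gA; exists f; split=> //.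
split; first by exists g.
  by rewrite -g0 gK.
by move=> v w; rewrite -gA !fK.
Qed.

Definition tree_aut_one := TreeAut is_tree_aut_id.
(* g * h is "g first, then h", as for the product of {perm T}. *)
Definition tree_aut_mul g h := TreeAut (is_tree_aut_comp g h).
Definition tree_aut_inv g :=
  let: exist _ fP := cid (tree_aut_inv_subproof g) in
  let: And3 f_aut _ _ := fP in TreeAut f_aut.

Lemma tree_aut_invP g :
  cancel g (tree_aut_inv g) /\ cancel (tree_aut_inv g) g.
Proof. by rewrite /tree_aut_inv; case: cid => f []. Qed.

Fact tree_aut_mulA : associative tree_aut_mul.
Proof. by move=> f g h; apply: tree_autP. Qed.

Fact tree_aut_mul1 : left_id tree_aut_one tree_aut_mul.
Proof. by move=> g; apply: tree_autP. Qed.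

Fact tree_aut_mulr1 : right_id tree_aut_one tree_aut_mul.
Proof. by move=> g; apply: tree_autP. Qed.

Fact tree_aut_mulV : left_inverse tree_aut_one tree_aut_inv tree_aut_mul.
Proof.
by move=> g; apply: tree_autP => w /=; rewrite (tree_aut_invP g).2.
Qed.

Fact tree_aut_mulVr : right_inverse tree_aut_one tree_aut_inv tree_aut_mul.
Proof.
by move=> g; apply: tree_autP => w /=; rewrite (tree_aut_invP g).1.
Qed.

End TreeAutGroup.

HB.instance Definition _ (T : Type) := isGroup.Build (tree_aut T)
  (@tree_aut_mulA T) (@tree_aut_mul1 T) (@tree_aut_mulr1 T)
  (@tree_aut_mulV T) (@tree_aut_mulVr T).

Definition subgroup_gen (G : groupType) (S : set G) : set G :=
  smallest (fun K : set G => group_closed (mem K)) S.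

Section Portrait.
Variable T : finType.
Implicit Types (f : seq T -> {perm T}) (s : {perm T}) (v w : seq T).

(* The automorphism whose restriction at v acts on the first level as f v,
   for every word v; see portrait_cat. *)
Fixpoint portrait_fun f w : seq T :=
  if w is x :: w' then f [::] x :: portrait_fun (fun v => f (x :: v)) w'
  else [::].

Lemma portrait_fun_cat f v w :
  portrait_fun f (v ++ w) =
  portrait_fun f v ++ portrait_fun (fun u => f (v ++ u)) w.
Proof. by elim: v f => //= x v IH f; rewrite IH. Qed.

Lemma size_portrait_fun f w : size (portrait_fun f w) = size w.
Proof. by elim: w f => //= x w IH f; rewrite IH. Qed.

Lemma portrait_fun_rcons f v x :
  portrait_fun f (rcons v x) = rcons (portrait_fun f v) (f v x).
Proof. by rewrite -!cats1 portrait_fun_cat /= cats0. Qed.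

Lemma portrait_fun_bij f : bijective (portrait_fun f).
Proof.
pose fix inv (h : seq T -> {perm T}) w := if w is x :: w' then
  let y := (h [::])^-1%g x in y :: inv (fun v => h (y :: v)) w' else [::].
exists (inv f) => w.
  by elim: w f => //= x w IH f; rewrite permK IH.
by elim: w f => //= x w IH f; rewrite permKV IH.
Qed.

Lemma portrait_fun_aut f : is_tree_aut (portrait_fun f).
Proof.
have fB := portrait_fun_bij f.
have sub v w : (exists x, portrait_fun f w = rcons (portrait_fun f v) x) <->
               (exists x, w = rcons v x).
  split=> [[x]|[x ->]]; last by rewrite portrait_fun_rcons; exists (f v x).
  case/lastP: w => [|w y] /=.
    by move/(congr1 size); rewrite size_rcons.
  rewrite portrait_fun_rcons => /rcons_inj [/(bij_inj fB) -> _].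
  by exists y.
by split=> // v w; rewrite /adjacent !sub.
Qed.

Definition portrait f := TreeAut (portrait_fun_aut f).

Lemma portrait_cat f v w :
  portrait f (v ++ w) = portrait f v ++ portrait (fun u => f (v ++ u)) w.
Proof. exact: portrait_fun_cat. Qed.

(* s acting on the first letter: (1, ..., 1)s *)
Definition rooted s : tree_aut T :=
  portrait (fun v => if v is [::] then s else 1%g).

Lemma rootedE s w : rooted s w = if w is x :: w' then s x :: w' else [::].
Proof.
case: w => //= x w; congr cons.
by elim: w => //= y w ->; rewrite perm1.
Qed.

End Portrait.

Section Directed.
Local Open Scope ring_scope.
Variable p : nat.
Implicit Types (e : 'Z_(p ^ 2) -> 'F_p) (i : 'Z_(p ^ 2)) (w : seq 'F_p).

Definition sigma : {perm 'F_p} := perm (@addIr 'F_p 1).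

Fixpoint directed_fun e i w : seq 'F_p :=
  if w is x :: w' then
    x :: (if x == 0 then directed_fun e (i + 1) w'
          else if x == 1 then rooted (sigma ^+ e i)%g w'
          else w')
  else [::].

Lemma directed_fun_portrait e i :
  exists f, directed_fun e i = portrait_fun f.
Proof.
pose fix lab i (v : seq 'F_p) : {perm 'F_p} := if v is x :: v' then
  if x == 0 then lab (i + 1) v' else
  if x == 1 then if v' is [::] then (sigma ^+ e i)%g else 1%g else 1%g
  else 1%g.
exists (lab i); apply: funext => w.
elim: w i => //= x w IH i; rewrite perm1; congr cons.
case: ifP => _ //; case: ifP => // _.
by elim: w {IH} => //= y w <-; rewrite perm1.
Qed.

Lemma directed_fun_aut e i : is_tree_aut (directed_fun e i).
Proof.
by have [f ->] := directed_fun_portrait e i; apply: portrait_fun_aut.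
Qed.

(* directed e i = (directed e (i + 1), sigma ^ e_i, 1, ..., 1) *)
Definition directed e i : tree_aut 'F_p := TreeAut (directed_fun_aut e i).

(* The index type 'Z_(p ^ 2) makes indices cyclic: lambda i = (alpha_i, beta_i)
   for i = 1, ..., p ^ 2 modulo p ^ 2. *)
Variable lambda : 'Z_(p ^ 2) -> 'F_p * 'F_p.

Definition u_exp i : 'F_p := if (lambda i).2 == 0 then 0 else 1.
Definition v_exp i : 'F_p :=
  if (lambda i).2 == 0 then 1 else - ((lambda i).1 / (lambda i).2).

Definition q_aut i : tree_aut 'F_p := directed u_exp i.
Definition r_aut i : tree_aut 'F_p := directed v_exp i.

End Directed.

Section GGroup.
Local Open Scope ring_scope.
Variable p : nat.

Definition transitive_set (P : set {perm 'F_p}) : Prop :=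
  forall x y, exists2 s, P s & s x = y.

Section Data.
Variables (R : {group {perm 'F_p}}) (D : groupType).
(* The sequence is indexed by i >= 1; w 0 is never used. *)
Variable w : nat -> {multiplicative D -> {perm 'F_p}}.

(* A word v is of the form 0^(i-1) 1 with i >= 1 iff
   v = 0^(size v - 1) 1, and then i = size v. *)
Definition hat (d : D) : tree_aut 'F_p :=
  @portrait 'F_p (fun v => if v == rcons (nseq (size v).-1 0) 1
                           then w (size v) d else 1%g).

Definition is_Ggroup (H : set (tree_aut 'F_p)) : Prop :=
  [/\ H = subgroup_gen ((@rooted _ @` [set s | s \in R]) `|` range hat),
      transitive_set [set s | s \in R]
        /\ (forall i, (0 < i)%N -> transitive_set (range (w i))),
      forall d, infinite_set [set i : nat | (0 < i)%N /\ w i d = 1%g]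
    & forall d, d <> 1%g ->
        infinite_set [set i : nat | (0 < i)%N /\ w i d <> 1%g]].

Definition periodic_seq (n : nat) : Prop :=
  forall i, (0 < i)%N -> w (i + n) =1 w i.

End Data.
End GGroup.

(* Main.v *)
(* The directed part is D = F_p x F_p with w_i (a, b) = sigma^(a u_i + b v_i),
   i modulo p^2, so that hat (a, b) = q_1^a r_1^b. The pairs (u_i, v_i) are never
   zero, hence every w_i is onto <sigma>, and as i varies they run through
   representatives of all the lines of F_p^2. So every (a, b) is orthogonal to
   some (u_i, v_i), and a nonzero (a, b) is not orthogonal to all of them;
   periodicity gives infinitely many such i. *)
Require Import Defs.
From HB Require Import structures.
From mathcomp Require Import all_boot all_order all_algebra all_fingroup.
From mathcomp Require Import boolp classical_sets functions cardinality.
Import GRing.Theory.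
Local Open Scope classical_set_scope.
Local Open Scope ring_scope.

Lemma group_closed_setP {G : groupType} (K : set G) :
  group_closed (mem K) <->
  K 1%g /\ forall x y, K x -> K y -> K (x * y^-1)%g.
Proof.
split=> -[K1 KB]; split.
- by move: K1; rewrite inE.
- by move=> x y Kx Ky; have := KB x y; rewrite !inE; apply.
- by rewrite inE.
- by move=> x y; rewrite !inE; apply: KB.
Qed.

Section SubgroupGen.
Context {G : groupType}.
Implicit Types S K : set G.

Lemma sub_subgroup_gen S : S `<=` subgroup_gen S.
Proof. exact: sub_gen_smallest. Qed.

Lemma subgroup_gen_closed S : group_closed (mem (subgroup_gen S)).
Proof.
apply/group_closed_setP; split=> [K [/group_closed_setP[]]//|x y Sx Sy K SK].
case/group_closed_setP: (SK.1) => _; apply; [exact: Sx | exact: Sy].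
Qed.

Lemma subgroup_genM S x y :
  subgroup_gen S x -> subgroup_gen S y -> subgroup_gen S (x * y)%g.
Proof.
move=> Sx Sy; have SM := group_closedM (subgroup_gen_closed S).
by have := SM x y; rewrite !inE; apply.
Qed.

Lemma subgroup_genX S x n : subgroup_gen S x -> subgroup_gen S (x ^+ n)%g.
Proof.
move=> Sx; elim: n => [|n IHn].
  by have /group_closed_setP[] := subgroup_gen_closed S.
by rewrite expgS; apply: subgroup_genM.
Qed.

Lemma subgroup_gen_sub S K :
  S `<=` subgroup_gen K -> subgroup_gen S `<=` subgroup_gen K.
Proof. by move=> SK; apply: smallest_sub => //; apply: subgroup_gen_closed. Qed.

End SubgroupGen.

Lemma rootedM (T : finType) (s t : {perm T}) :
  rooted (s * t)%g = (rooted s * rooted t)%g.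
Proof.
apply: tree_autP => w.
rewrite -[RHS]/(rooted t (rooted s w)) !rootedE.
by case: w => // x w; rewrite permM.
Qed.

Lemma rooted1 (T : finType) : rooted (1%g : {perm T}) = 1%g.
Proof. by apply: tree_autP => -[|x w]; rewrite rootedE // perm1. Qed.

Lemma rootedX (T : finType) (s : {perm T}) n :
  rooted (s ^+ n)%g = (rooted s ^+ n)%g.
Proof.
elim: n => [|n IHn]; first exact: rooted1.
by rewrite !expgS rootedM IHn.
Qed.

Lemma eq_portrait (T : finType) (f g : seq T -> {perm T}) :
  f =1 g -> portrait f = portrait g.
Proof. by move/funext->. Qed.

(** The set contains the progression [m + k * n], which is unbounded as [n] is positive. *)
Lemma infinite_set_nat_shift (A : set nat) (m n : nat) :
  (0 < n)%N -> A m -> (forall i, A i -> A (i + n)%N) -> infinite_set A.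
Proof.
move=> n_gt0 Am An.
have Ak k : A (m + k * n)%N.
  by elim: k => [|k IHk]; rewrite ?addn0 // mulSnr addnA; apply: An.
case/finite_seqP => s As; set M := (\max_(i <- s) i)%N.
(* With [k = M.+1] the term is at least [M + 1], above every listed element. *)
have: (m + M.+1 * n)%N \in s by have := Ak M.+1; rewrite As.
move=> sM; have := @leq_bigmax_seq _ s xpredT id _ sM isT.
apply/negP; rewrite -ltnNge -/M.
by rewrite (leq_trans (leq_pmulr _ n_gt0)) // leq_addl.
Qed.

Section Sigma.
Context {p : nat}.
Implicit Types (a b : 'F_p) (e : 'Z_(p ^ 2) -> 'F_p).

Lemma sigmaXE n (x : 'F_p) : (sigma p ^+ n)%g x = x + n%:R.
Proof.
elim: n => [|n IHn]; first by rewrite perm1 addr0.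
by rewrite expgSr permM IHn permE -addrA natr1.
Qed.

Lemma sigmaX_F a x : (sigma p ^+ a)%g x = x + a.
Proof. by rewrite sigmaXE natr_Zp. Qed.

(** On the left the sum is reduced in ['F_p] before its representative becomes the exponent. Both
    sides are the translation by [a + b]. *)
Lemma sigmaXD a b : (sigma p ^+ (a + b)%R = sigma p ^+ a * sigma p ^+ b)%g.
Proof. by apply/permP => x; rewrite permM !sigmaX_F addrA. Qed.

Lemma sigmaX_eq1 a : (sigma p ^+ a)%g = 1%g -> a = 0.
Proof. by move/permP/(_ 0); rewrite sigmaX_F perm1 add0r. Qed.

Lemma directed_cons e i x w : directed e i (x :: w) =
  x :: (if x == 0 then directed e (i + 1) w
        else if x == 1 then rooted (sigma p ^+ e i)%g w else w).
Proof. by []. Qed.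

(** Both factors fix the first level, so restrictions multiply letter by letter: recursively at 0,
    as powers of [sigma] at 1. *)
Lemma directedD e1 e2 i :
  directed (fun j => e1 j + e2 j) i = (directed e1 i * directed e2 i)%g.
Proof.
apply: tree_autP => w; rewrite -[RHS]/(directed e2 i (directed e1 i w)).
elim: w i => // x w IHw i; rewrite !directed_cons; congr cons.
have [_|_] := ifP; first exact: IHw.
by case: ifP => // _; rewrite sigmaXD rootedM.
Qed.

Lemma directed0 i : directed (fun=> 0 : 'F_p) i = 1%g.
Proof.
apply: tree_autP => w; rewrite -[RHS]/w.
elim: w i => // x w IHw i; rewrite directed_cons; congr cons.
by have [_|_] := ifP; [exact: IHw | rewrite rooted1 if_same].
Qed.

Lemma directedX e i n :
  directed (fun j => n%:R * e j) i = (directed e i ^+ n)%g.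
Proof.
elim: n => [|n IHn].
  by rewrite expg0 -(directed0 i); congr directed; apply: funext => j; rewrite mul0r.
rewrite expgS -IHn -directedD; congr directed; apply: funext => j.
by rewrite -natr1 mulrDl mul1r addrC.
Qed.

Lemma directedZ e i a : directed (fun j => a * e j) i = (directed e i ^+ a)%g.
Proof. by rewrite -directedX natr_Zp. Qed.

(** Each leading 0 raises the index by one, so the word with [k] zeros followed by 1 carries the
    exponent at [i + k]. This turns the recursion for [directed] into the form used by [hat]. *)
Lemma directed_portrait e i :
  directed e i = @portrait 'F_p (fun v => if v == rcons (nseq (size v).-1 0) 1
    then (sigma p ^+ e (i + (size v).-1%:R)%R)%g else 1%g).
Proof.
apply: tree_autP => w; elim: w i => // x w IHw i.
rewrite directed_cons [RHS]/= perm1; congr cons.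
have [->|x_neq0] := eqVneq x 0.
  rewrite -[LHS]/(directed e (i + 1) w) IHw.
  congr portrait_fun; apply: funext => -[|y v] //=.
  by rewrite [in RHS]eqseq_cons eqxx -natr1 [_ + 1 in RHS]addrC addrA.
have [->|x_neq1] := eqVneq x 1.
  rewrite -[LHS]/(portrait_fun _ w); congr portrait_fun; apply: funext.
  by case=> [|y v]; rewrite /= ?eqxx ?addr0 // eqseq_cons oner_eq0.
(* Below any other letter nothing moves; writing the identity as a rooted automorphism makes both
   sides portraits, whose labels can be compared. *)
rewrite -[LHS]/((1%g : tree_aut 'F_p) w) -rooted1.
rewrite -[LHS]/(portrait_fun _ w); congr portrait_fun; apply: funext.
by case=> [|y v] /=; rewrite eqseq_cons ?(negPf x_neq0) ?(negPf x_neq1).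
Qed.

End Sigma.

Section DirectedPart.
Context {p : nat}.
Variable lambda : 'Z_(p ^ 2) -> 'F_p * 'F_p.

Definition weight (d : 'F_p * 'F_p) (i : 'Z_(p ^ 2)) : 'F_p :=
  d.1 * u_exp lambda i + d.2 * v_exp lambda i.

Definition weight_perm (i : nat) (d : 'F_p * 'F_p) : {perm 'F_p} :=
  (sigma p ^+ weight d i%:R)%g.

Lemma weight_permM i : {morph weight_perm i : d1 d2 / (d1 * d2)%g}.
Proof.
move=> d1 d2; rewrite /weight_perm -sigmaXD; congr (_ ^+ _)%g; congr nat_of_ord.
(* The group product of pairs is componentwise addition in ['F_p]. *)
rewrite /weight -[(d1 * d2)%g.1]/(d1.1 + d2.1) -[(d1 * d2)%g.2]/(d1.2 + d2.2).
by rewrite !mulrDl addrACA.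
Qed.

HB.instance Definition _ i :=
  isMultiplicative.Build _ _ (weight_perm i) (weight_permM i).

Lemma hat_directed d : hat weight_perm d = directed (weight d) 1.
Proof.
rewrite directed_portrait; apply: eq_portrait => v; case: ifP => // /eqP v_def.
(* Starting at index 1, the word of length [i] gets index [1 + (i - 1) = i]; the length is positive
   because the word ends in 1. *)
by rewrite /weight_perm nat1r prednK // v_def size_rcons.
Qed.

(* In %g scope the index 1 would denote 0, the unit of the additive group. *)
Lemma hatE d : hat weight_perm d =
  (q_aut lambda 1%R ^+ d.1 * r_aut lambda 1%R ^+ d.2)%g.
Proof. by rewrite hat_directed /q_aut /r_aut -2!directedZ -directedD. Qed.

Hypothesis p_prime : prime p.

Lemma char_Zp2 : (p ^ 2)%:R = 0 :> 'Z_(p ^ 2).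
Proof. by rewrite pchar_Zp // (ltn_exp2l 0) ?prime_gt1. Qed.

Lemma weight_perm_period i : weight_perm (i + p ^ 2) = weight_perm i.
Proof. by apply: funext => d; rewrite /weight_perm natrD char_Zp2 addr0. Qed.

(** One of [u_exp] and [v_exp] equals 1 at the index, so putting [y - x] in that coordinate and 0 in
    the other gives the translation from [x] to [y]. *)
Lemma weight_perm_surj i x y : exists d, weight_perm i d x = y.
Proof.
have [b0|b0] := eqVneq (lambda i%:R).2 0.
  exists (0, y - x); rewrite sigmaX_F /weight /v_exp /u_exp b0 eqxx /=.
  by rewrite mul0r add0r mulr1 addrC subrK.
exists (y - x, 0); rewrite sigmaX_F /weight /v_exp /u_exp (negPf b0) /=.
by rewrite mul0r addr0 mulr1 addrC subrK.
Qed.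

Hypothesis lambda_bij : bijective lambda.

Lemma weight_zero d : exists i, weight d i = 0.
Proof.
have [f _ fK] := lambda_bij; case: d => a b.
have [->|b0] := eqVneq b 0.
  (* Here [(u, v) = (0, 1)], and the weight is [b = 0]. *)
  exists (f (0, 0)); rewrite /weight /u_exp /v_exp fK eqxx /=.
  by rewrite mulr0 mul0r addr0.
(* Here [(u, v) = (1, - (a / b))], and the weight is [a - b * (a / b)]. *)
exists (f (a / b, 1)); rewrite /weight /u_exp /v_exp fK oner_eq0 /=.
by rewrite mulr1 divr1 mulrN mulrC divfK // subrr.
Qed.

Lemma weight_nonzero d : d <> 1%g -> exists i, weight d i <> 0.
Proof.
have [f _ fK] := lambda_bij; case: d => a b d_neq1.
have [b0|b0] := eqVneq b 0.
  (* Here [(u, v) = (1, 0)] reads off [a]; in the other case [(0, 1)] reads off [b]. *)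
  exists (f (0, 1)); rewrite /weight /u_exp /v_exp fK oner_eq0 /=.
  rewrite b0 mulr1 mul0r addr0 => a0; apply: d_neq1; rewrite a0 b0; reflexivity.
exists (f (0, 0)); rewrite /weight /u_exp /v_exp fK eqxx /=.
by rewrite mulr0 mulr1 add0r; apply/eqP.
Qed.

Lemma infinite_weight_perm (P : {perm 'F_p} -> Prop) d :
  (exists i : 'Z_(p ^ 2), P (sigma p ^+ weight d i)%g) ->
  infinite_set [set i : nat | (0 < i)%N /\ P (weight_perm i d)].
Proof.
have p2_gt0 : (0 < p ^ 2)%N by rewrite expn_gt0 prime_gt0.
(* The residue [i] may be 0, so the progression starts one period later to stay positive. *)
case=> i Pi; apply: (infinite_set_nat_shift _ (i + p ^ 2)%N _ p2_gt0) => [|j [j_gt0 Pj]].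
  by split; rewrite ?addn_gt0 ?p2_gt0 ?orbT // weight_perm_period /weight_perm natr_Zp.
by split; rewrite ?weight_perm_period // addn_gt0 j_gt0.
Qed.

End DirectedPart.

Theorem proposition12 (p : nat) (p_prime : prime p) (p_gt2 : (2 < p)%N)
    (lambda : 'Z_(p ^ 2) -> 'F_p * 'F_p) (lambda_bij : bijective lambda) :
  exists (R : {group {perm 'F_p}}) (D : finGroupType)
         (w : nat -> {multiplicative D -> {perm 'F_p}}),
    is_Ggroup R w
      (subgroup_gen [set q_aut lambda 1; r_aut lambda 1; rooted (sigma p)])
    /\ periodic_seq w (p ^ 2).
Proof.
exists <[sigma p]>%G, ('F_p * 'F_p)%type, (fun i => weight_perm lambda i).
split; last by move=> i _ d; rewrite /= weight_perm_period.
split.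
- apply/seteqP; split; apply: subgroup_gen_sub => g.
    case=> [[|]|] ->; apply: sub_subgroup_gen.
    + by right; exists (1, 0) => //=; rewrite hatE expg1 expg0 mulg1.
    + by right; exists (0, 1) => //=; rewrite hatE expg1 expg0 mul1g.
    + by left; exists (sigma p) => //=; apply: cycle_id.
  (* Conversely, rooted elements are powers of [rooted (sigma p)], and each [hat] is a power of
     [q_aut] times a power of [r_aut]. *)
  case=> [[s /cycleP[n ->] <-]|[d _ <-]].
    by rewrite rootedX; apply: subgroup_genX; apply: sub_subgroup_gen; right.
  rewrite hatE; apply: subgroup_genM; apply: subgroup_genX; apply: sub_subgroup_gen.
    by left; left.
  by left; right.
- split=> [x y|i _ x y].
    exists (sigma p ^+ (y - x)%R)%g; first exact: mem_cycle.
    by rewrite sigmaX_F addrC subrK.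
  have [d dxy] := weight_perm_surj lambda i x y.
  by exists (weight_perm lambda i d) => //; exists d.
- move=> d; apply: (infinite_weight_perm lambda p_prime (fun s => s = 1%g)).
  by have [i di] := weight_zero lambda lambda_bij d; exists i; rewrite di.
- move=> d d1; apply: (infinite_weight_perm lambda p_prime (fun s => s <> 1%g)).
  have [i di] := weight_nonzero lambda lambda_bij d d1.
  by exists i => /sigmaX_eq1.
Qed.
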